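(* Let $1<c<n$ be integers, write $n=cq+r$ with $0\le r<c$, and let $\gamma<0$. For every connected graph $G$ of order $n$ with chromatic number $c$, \[{}^0R_{\gamma}(G)\ge (c-r)\left\lfloor\tfrac{n}{c}\right\rfloor\left(n-\left\lfloor\tfrac{n}{c}\right\rfloor\right)^{\gamma}+r\left\lceil\tfrac{n}{c}\right\rceil\left(n-\left\lceil\tfrac{n}{c}\right\rceil\right)^{\gamma},\] with equality if and only if $G=T_n(c)$.
   Context: ${}^0R_{\gamma}(G)=\sum_{u\in V(G)} d(u)^{\gamma}$. The Turán graph $T_n(c)$ is the complete $c$-partite graph of order $n$ whose partite sets differ in size by at most 1. Graphs are finite and simple. *)

(* Defs.v *)
From HB Require Import structures.
From mathcomp Require Import all_boot all_order all_algebra.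
From mathcomp Require Import all_classical all_reals all_analysis.

Set Implicit Arguments.
Unset Strict Implicit.
Unset Printing Implicit Defensive.

Import Order.TTheory GRing.Theory Num.Theory.

Local Open Scope ring_scope.

Record sgraph := SGraph {
  vertex :> finType;
  adj : rel vertex;
  adj_sym : symmetric adj;
  adj_irr : irreflexive adj
}.

Definition deg (G : sgraph) (u : G) : nat := #|[set v : G | adj u v]|.

Definition connected_graph (G : sgraph) : Prop :=
  forall x y : G, connect (@adj G) x y.

Definition colorable (G : sgraph) (k : nat) : bool :=
  [exists f : {ffun G -> 'I_k},
    [forall x : G, forall y : G, adj x y ==> (f x != f y)]].

Lemma colorable_card (G : sgraph) : exists k, colorable G k.
Proof.
exists #|G|; apply/existsP; exists [ffun x => enum_rank x].
apply/forallP => x; apply/forallP => y; apply/implyP => xy.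
rewrite !ffunE (inj_eq enum_rank_inj).
by apply: contraTneq xy => ->; rewrite adj_irr.
Qed.

Definition chromatic_number (G : sgraph) : nat := ex_minn (colorable_card G).

Definition general_zeroth_randic (R : realType) (gamma : R) (G : sgraph) : R :=
  \sum_(u : G) (deg u)%:R `^ gamma.

(* "G = T_n(c)" is equality of unlabelled graphs: f sends a vertex to its
   partite set.  For c <= n the size condition makes every partite set
   nonempty. *)
Definition is_turan (n c : nat) (G : sgraph) : Prop :=
  #|G| = n /\
  exists f : G -> 'I_c,
    (forall x y : G, adj x y = (f x != f y)) /\
    (forall i j : 'I_c,
       (#|[set x : G | f x == i]| <= #|[set x : G | f x == j]|.+1)%N).

(* Main.v *)
(** Fix a proper colouring f of G with c colours and class sizes N_i.  A vertex
    u has degree at most n - N_(f u), with equality for all u iff G is complete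
    multipartite, so the index is at least the sum of h(N_i) where
    h(x) = x (n - x)^gamma.  On the integers 0 <= x < n, h is strictly convex, so
    it lies above the line through its values at q and q + 1, touching it only
    there; as the N_i sum to c q + r, the line sums to the stated bound. *)
Require Import Defs.
From HB Require Import structures.
From mathcomp Require Import all_boot all_order all_algebra.
From mathcomp Require Import all_classical all_reals all_analysis.
From mathcomp Require Import zify ring lra.

Set Implicit Arguments.
Unset Strict Implicit.
Unset Printing Implicit Defensive.

Import Order.TTheory GRing.Theory Num.Theory.

Local Open Scope ring_scope.

Lemma ltr_powR_neg (R : realType) (g x y : R) :
  g < 0 -> 0 < x -> x < y -> y `^ g < x `^ g.
Proof.
move=> g0 x0 xy; have y0 := lt_trans x0 xy.
rewrite -[g]opprK ![_ `^ (- - g)]powRN ltf_pV2 ?posrE ?powR_gt0 //.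
by apply: gt0_ltr_powR; rewrite ?nnegrE ?ltW // oppr_gt0.
Qed.

Lemma ler_powR_neg (R : realType) (g x y : R) :
  g < 0 -> 0 < x -> x <= y -> y `^ g <= x `^ g.
Proof.
move=> g0 x0; rewrite le_eqVlt => /predU1P[->//|xy].
exact/ltW/ltr_powR_neg.
Qed.

(* By AM-GM the right-hand side is at least 2 ((y - 1)(y + 1))^(g / 2). *)
Lemma powR_neg_midpoint (R : realType) (g y : R) :
  g < 0 -> 1 < y -> 2 * y `^ g <= (y - 1) `^ g + (y + 1) `^ g.
Proof.
move=> g0 y1.
have sqr_half (x : R) : 0 < x -> x `^ g = x `^ (g / 2) * x `^ (g / 2).
  by move=> x0; rewrite -powRD -?splitr // (gt_eqF x0) implybT.
(* Here (y - 1)(y + 1) < y^2, and the negative exponent g / 2 reverses the comparison. *)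
have le_half : y `^ g <= (y - 1) `^ (g / 2) * (y + 1) `^ (g / 2).
  rewrite sqr_half -?powRM; try lra.
  by apply: ler_powR_neg; nra.
rewrite (sqr_half (y - 1)) 1?(sqr_half (y + 1)); try lra.
have := sqr_ge0 ((y - 1) `^ (g / 2) - (y + 1) `^ (g / 2)).
by move: le_half; set s := (y - 1) `^ _; set t := (y + 1) `^ _; nra.
Qed.

(** Subtracting the secant line leaves a strictly convex [d] that vanishes at q and q + 1, hence
    grows strictly away from these two points on either side. *)
Lemma discrete_convex_secant (R : realType) (n q : nat) (h : nat -> R) :
  (forall x, (x.+2 < n)%N -> 2 * h x.+1 < h x + h x.+2) -> (q.+1 < n)%N ->
  forall x, (x < n)%N ->
    h q + (x%:R - q%:R) * (h q.+1 - h q) <= h x ?= iff (x == q) || (x == q.+1).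
Proof.
move=> hconv qn x xn.
pose L (y : nat) : R := h q + (y%:R - q%:R) * (h q.+1 - h q).
pose d y := h y - L y.
have dq : d q = 0 by rewrite /d /L; ring.
have dqS : d q.+1 = 0 by rewrite /d /L -natr1; ring.
have dconv y : (y.+2 < n)%N -> 2 * d y.+1 < d y + d y.+2.
  by move=> yn; have := hconv y yn; rewrite /d /L -[y.+2%:R]natr1 -[y.+1%:R]natr1; lra.
(* Convexity passes a positive increment on to the next one. The lower bound on [d] is weak because
   [d] is zero at the starting point q + 1. *)
have above k : (q + k.+2 < n)%N -> 0 <= d (q + k.+1)%N < d (q + k.+2)%N.
  elim: k => [|k IH] kn.
    by have := dconv q; rewrite addn1 addn2 dq dqS -addn2 => /(_ kn); lra.
  have := dconv (q + k.+1)%N; rewrite -!addnS addnS => /(_ kn).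
  have /IH : (q + k.+2 < n)%N by lia.
  by lra.
have below k : (k < q)%N -> 0 <= d (q - k)%N < d (q - k.+1)%N.
  elim: k => [|k IH] kq.
    have := dconv (q - 1)%N; rewrite subn0.
    have -> : (q - 1).+1 = q by lia.
    by rewrite dq dqS => /(_ qn); lra.
  have := dconv (q - k.+2)%N.
  have -> : (q - k.+2).+1 = (q - k.+1)%N by lia.
  have -> : (q - k.+1).+1 = (q - k)%N by lia.
  have kn : (q - k < n)%N by lia.
  by move=> /(_ kn); have /IH := ltnW kq; lra.
rewrite -/(L x); apply/leifP; case: ifP => [/orP[]/eqP xE|/norP[/eqP xq /eqP xqS]].
- by have := dq; rewrite -xE => /subr0_eq/esym/eqP.
- by have := dqS; rewrite -xE => /subr0_eq/esym/eqP.
rewrite -subr_gt0 -/(d x); have [xltq|qltx] := leqP x.+1 q.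
  have := below (q - x.+1)%N.
  have -> : (q - (q - x.+1).+1 = x)%N by lia.
  have kq : (q - x.+1 < q)%N by lia.
  by move=> /(_ kq); lra.
have := above (x - q.+2)%N.
have -> : (q + (x - q.+2).+2 = x)%N by lia.
by move=> /(_ xn); lra.
Qed.

(** This is h: the share of the index due to a part of size x in a complete multipartite graph of
    order n. *)
Definition part_weight (R : realType) (g : R) (n x : nat) : R :=
  x%:R * (n - x)%:R `^ g.

(** With y = n - x - 1, the second difference is x ((y - 1)^g + (y + 1)^g - 2 y^g) + 2 ((y - 1)^g -
    y^g). The first term is nonnegative by the midpoint inequality; the second is positive, so
    strictness holds even at x = 0. *)
Lemma part_weight_convex (R : realType) (g : R) (n x : nat) :
  g < 0 -> (x.+2 < n)%N ->
  2 * part_weight g n x.+1 < part_weight g n x + part_weight g n x.+2.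
Proof.
move=> g0 xn; rewrite /part_weight.
pose y : R := (n - x.+1)%:R.
have y1 : 1 < y by rewrite /y ltr1n; lia.
have -> : (n - x)%:R = y + 1 by rewrite /y natr1; congr _%:R; lia.
have -> : (n - x.+2)%:R = y - 1.
  by apply: (addIr 1); rewrite subrK natr1 /y; congr _%:R; lia.
have mid := @powR_neg_midpoint R g y g0 y1.
have lty : y `^ g < (y - 1) `^ g by apply: ltr_powR_neg; lra.
have x0 : 0 <= x%:R :> R by [].
rewrite -[x.+2%:R]natr1 -[x.+1%:R]natr1 -/y; nra.
Qed.

Lemma card_color_classes (T I : finType) (f : T -> I) :
  (\sum_i #|[set x | f x == i]| = #|T|)%N.
Proof.
rewrite -sum1_card (partition_big f xpredT) //=.
by apply: eq_bigr => i _; rewrite -sum1_card; apply: eq_bigl => x; rewrite inE.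
Qed.

(** A class smaller than q would force all others to be at most q, making the sum too small; one
    larger than q + 1 would force all others to be at least q + 1, making it too large since r <
    #|I|. *)
Lemma balanced_classes (I : finType) (N : I -> nat) (q r : nat) :
  (r < #|I|)%N -> (\sum_i N i = #|I| * q + r)%N ->
  (forall i j, N i <= (N j).+1)%N ->
  forall i, (N i == q) || (N i == q.+1).
Proof.
move=> rI sN bal i.
have sumD1 (k : nat) : (\sum_(j : I | j != i) k + k = #|I| * k)%N.
  by rewrite -sum_nat_const [RHS](bigD1 i) //= addnC.
move: sN; rewrite (bigD1 i) //= => sN.
have [Nq|qN] := ltnP (N i) q.
  suff : (\sum_(j | j != i) N j <= \sum_(j : I | j != i) q)%N.
    move: sN (sumD1 q).
    by move: (bigop _ _ _) (bigop _ _ _) (#|I| * q)%N => A B P; lia.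
  by apply: leq_sum => j _; have := bal j i; lia.
have [Nq|{}qN] := leqP (N i) q.+1; first by lia.
suff : (\sum_(j : I | j != i) q.+1 <= \sum_(j | j != i) N j)%N.
  move: sN (sumD1 q.+1); rewrite mulnS.
  by move: (bigop _ _ _) (bigop _ _ _) (#|I| * q)%N => A B P; lia.
by apply: leq_sum => j _; have := bal i j; lia.
Qed.

(** Needed because negative powers decrease only on positive reals: by convention 0 to a negative
    power is 0. *)
Lemma deg_gt0 (G : sgraph) (u : G) :
  connected_graph G -> (1 < #|G|)%N -> (0 < deg u)%N.
Proof.
move=> conG G1; rewrite /deg card_gt0; apply/set0Pn.
have [v vu] : exists v, v != u.
  have : (0 < #|[set~ u]|)%N by rewrite cardsC1; lia.
  by rewrite card_gt0 => /set0Pn[v]; rewrite !inE; exists v.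
case/connectP: (conG u v) => -[|w p] /= => [_ vE|/andP[uw _] _].
  by rewrite vE eqxx in vu.
by exists w; rewrite inE.
Qed.

(** Neighbours of u lie outside its colour class, and equality means that they fill the
    complement. *)
Lemma deg_leif_color_class (G : sgraph) (I : eqType) (f : G -> I) (u : G) :
  (forall x y, adj x y -> f x != f y) ->
  (deg u <= #|G| - #|[set x | f x == f u]|
    ?= iff [forall v, adj u v == (f u != f v)])%N.
Proof.
move=> fP; set C := [set x | _].
have -> : (#|G| - #|C| = #|~: C|)%N by rewrite [in RHS]cardsCs finset.setCK.
have sub : [set v : G | adj u v] \subset ~: C.
  by apply/fintype.subsetP => v; rewrite !inE eq_sym; apply: fP.
rewrite /deg; have := subset_leqif_cards sub; congr (leqif _ _ _).
apply/eqP/forallP => [E v|E].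
  by have /finset.setP/(_ v) := E; rewrite !inE [f v == _]eq_sym => ->.
by apply/finset.setP => v; rewrite !inE [f v == _]eq_sym (eqP (E v)).
Qed.

Lemma sum_color_class_weight (R : realType) (g : R) (G : sgraph) (c : nat)
    (f : G -> 'I_c) :
  \sum_(u : G) (#|G| - #|[set x | f x == f u]|)%:R `^ g =
  \sum_(i < c) part_weight g #|G| #|[set x | f x == i]|.
Proof.
rewrite (partition_big f xpredT) //=; apply: eq_bigr => i _.
rewrite /part_weight mulr_natl -sumr_const.
by apply: eq_big => [x|x /eqP ->//]; rewrite inE.
Qed.

(** Chains the secant bound on class sizes with the degree bound at each vertex; the two equality
    conditions are conjoined. The colouring is arbitrary, so that a Turán partition can serve as
    well. *)
Lemma randic_leif (R : realType) (g : R) (G : sgraph) (c q r : nat)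
    (f : G -> 'I_c) :
  g < 0 -> connected_graph G -> (1 < #|G|)%N -> (q.+1 < #|G|)%N ->
  #|G| = (c * q + r)%N ->
  (forall x y, adj x y -> f x != f y) ->
  (c%:R - r%:R) * part_weight g #|G| q + r%:R * part_weight g #|G| q.+1
    <= general_zeroth_randic g G
    ?= iff [forall i, (#|[set x | f x == i]| == q) || (#|[set x | f x == i]| == q.+1)]
           && [forall u, forall v, adj u v == (f u != f v)].
Proof.
move=> g0 conG G1 qG Gn fP.
pose N i := #|[set x | f x == i]|.
have d0 u := @deg_gt0 G u conG G1.
have leN u := deg_leif_color_class u fP.
(* A member of a class has positive degree, so no class is all of G; sizes thus stay where h is
   convex. *)
have NltG i : (N i < #|G|)%N.
  have [/eqP|] := posnP (N i); first by move/eqP => ->; lia.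
  rewrite /N card_gt0 => /set0Pn[u]; rewrite inE => /eqP fu.
  by have := d0 u; have [] := leN u; rewrite fu; lia.
pose h := part_weight g #|G|.
pose L (x : nat) := h q + (x%:R - q%:R) * (h q.+1 - h q).
(* As L is affine, the sum is c h(q) + (n - c q)(h(q + 1) - h(q)), and n - c q = r. *)
have -> : (c%:R - r%:R) * h q + r%:R * h q.+1 = \sum_i L (N i).
  rewrite /L big_split /= sumr_const card_ord -mulr_suml sumrB sumr_const card_ord.
  rewrite -natr_sum card_color_classes Gn natrD natrM -[h q *+ c]mulr_natl.
  by rewrite -[q%:R *+ c]mulr_natl; ring.
apply: (@leif_trans _ _ _ (\sum_i h (N i))).
  apply: (@leif_sum _ _ xpredT) => i _.
  apply: (@discrete_convex_secant R #|G|) => // x xn.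
  exact: part_weight_convex.
rewrite -sum_color_class_weight /general_zeroth_randic.
apply: (@leif_sum _ _ xpredT (fun u => [forall v, adj u v == (f u != f v)])).
move=> u _; apply/leifP.
have [le_deg eq_deg] := leN u.
rewrite -eq_deg; case: ifPn => [/eqP ->//|ne_deg].
apply: ltr_powR_neg => //; first by rewrite ltr0n d0.
by rewrite ltr_nat ltn_neqAle ne_deg.
Qed.

Lemma floor_divn (R : realType) (c q r : nat) :
  (r < c)%N -> Num.floor ((c * q + r)%:R / c%:R : R) = q.
Proof.
move=> rc; have c0 : 0 < c%:R :> R by rewrite ltr0n; lia.
apply: floor_def; rewrite ler_pdivlMr // ltr_pdivrMr //.
rewrite intrD mulr1z -!pmulrn natr1 -!natrM ler_nat ltr_nat; lia.
Qed.

Lemma ceil_divn (R : realType) (c q r : nat) :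
  (0 < r < c)%N -> Num.ceil ((c * q + r)%:R / c%:R : R) = q.+1.
Proof.
move=> rc; have c0 : 0 < c%:R :> R by rewrite ltr0n; lia.
have qE : q.+1%:Z - 1 = q by lia.
apply: ceil_def; rewrite qE ler_pdivrMr // ltr_pdivlMr //.
rewrite -!pmulrn -!natrM ler_nat ltr_nat; lia.
Qed.

Lemma chromatic_coloring (G : sgraph) (c : nat) : chromatic_number G = c ->
  exists f : G -> 'I_c, forall x y, adj x y -> f x != f y.
Proof.
rewrite /chromatic_number; case: ex_minnP => k /existsP[f /forallP fP] _ <-.
by exists f => x y; have /forallP/(_ y)/implyP := fP x.
Qed.

Theorem theorem3p2 (R : realType) (n c q r : nat) (gamma : R) (G : sgraph)
  (c_gt1 : (1 < c)%N) (c_lt_n : (c < n)%N)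
  (n_eq : n = (c * q + r)%N) (r_lt_c : (r < c)%N)
  (gamma_lt0 : gamma < 0)
  (G_connected : connected_graph G)
  (G_order : #|G| = n)
  (G_chromatic : chromatic_number G = c) :
  let fl : R := (Num.floor (n%:R / c%:R : R))%:~R in
  let ce : R := (Num.ceil (n%:R / c%:R : R))%:~R in
  let bound : R :=
    (c%:R - r%:R) * fl * (n%:R - fl) `^ gamma
    + r%:R * ce * (n%:R - ce) `^ gamma in
  bound <= general_zeroth_randic gamma G /\
  (general_zeroth_randic gamma G = bound <-> is_turan n c G).
Proof.
move=> fl ce bound.
(* From c < n, q is positive, and q = 1 forces r > 0. *)
have qn : (q.+1 < n)%N by nia.
have flE : fl = q%:R by rewrite /fl n_eq floor_divn // -pmulrn.
have boundE : bound = (c%:R - r%:R) * part_weight gamma #|G| q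
                      + r%:R * part_weight gamma #|G| q.+1.
  rewrite /bound /part_weight G_order flE !natrB ?mulrA; try lia.
  (* For r = 0 the ceiling is q rather than q + 1, but its term has the factor r. *)
  have [r0|r0] := posnP r; first by rewrite r0 !mul0r.
  by rewrite /ce [in Num.ceil _]n_eq ceil_divn ?r0 // -pmulrn.
have G1 : (1 < #|G|)%N by lia.
have qG : (q.+1 < #|G|)%N by rewrite G_order.
have lef f := @randic_leif R gamma G c q r f gamma_lt0 G_connected G1 qG
  (etrans G_order n_eq).
rewrite -boundE in lef.
have [f fP] := chromatic_coloring G_chromatic.
split; first by case: (lef f fP).
split=> [/esym/eqP|[_ [k [kP kbal]]]].
  have [_ ->] := lef f fP => /andP[/forallP sz /forallP adjE].
  split=> //; exists f; split=> [x y|i j].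
    by have /forallP/(_ y)/eqP := adjE x.
  by have := sz i; have := sz j; lia.
(* For the converse, the equality case is applied to the Turán partition [k] itself instead of
   [f]. *)
have kproper x y : adj x y -> k x != k y by rewrite kP.
apply/esym/eqP; have [_ ->] := lef k kproper; apply/andP; split.
  apply/forallP; apply: (@balanced_classes _ (fun i => #|[set x | k x == i]|) q r) => //.
    by rewrite card_ord.
  by rewrite card_color_classes card_ord G_order.
by apply/forallP => x; apply/forallP => y; rewrite kP.
Qed.
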